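(* Let $A=(a_{ij})_{i,j\ge 1}$ be the infinite matrix given by $$a_{ij}=\begin{cases} j(j+1) & \text{if } i\ge j-1,\\ 0 & \text{if } i<j-1.\end{cases}$$ Let $(t_{n,m})_{0\le m\le n}$ be the triangle generated by $A$. Then the first column $(t_{n,0})_{n\ge 0}$ of this triangle is the sequence of tangent numbers $\big(\tan^{(2n-1)}(0)\big)_{n\ge 1}$, i.e. $t_{n,0}=\tan^{(2n+1)}(0)$ for all $n\ge 0$.
   Context: Triangle generated by an infinite matrix: for an infinite matrix $A=(a_{ij})_{i,j\ge 1}$ let $A^{(n)}$ ($n\ge 1$) be the $n\times(n+1)$ submatrix formed by the first $n$ rows and the first $n+1$ columns. Put $t_{0,0}=1$ and define row vectors $\bar t_n=(t_{n,0},t_{n,1},\dots,t_{n,n})$ by $\bar t_1=A^{(1)}$ and $\bar t_n=\bar t_{n-1}A^{(n)}=A^{(1)}A^{(2)}\cdots A^{(n)}$ for $n>1$. The array $(t_{n,m})_{0\le m\le n}$ is the triangle generated by $A$. $\tan^{(k)}(0)$ denotes the $k$-th derivative of the tangent function at $0$; the tangent numbers are the numbers $\tan^{(2n-1)}(0)$, $n\ge 1$. *)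

(* Defs.v *)
From mathcomp Require Import all_boot all_order all_algebra.
From mathcomp Require Import all_classical all_reals all_analysis.

Set Implicit Arguments.
Unset Strict Implicit.
Unset Printing Implicit Defensive.

Import GRing.Theory.

Local Open Scope ring_scope.

(* An infinite matrix (a_ij)_{i,j >= 1} is a function A : nat -> nat -> R used
   only at positive indices: A i j is a_ij.  Finite matrices are indexed from 0,
   hence the shifts. *)
Definition leading_submx (R : nzRingType) (A : nat -> nat -> R) (n : nat) :
    'M[R]_(n, n.+1) :=
  \matrix_(i < n, j < n.+1) A i.+1 j.+1.

Fixpoint triangle_row (R : nzRingType) (A : nat -> nat -> R) (n : nat) :
    'rV[R]_n.+1 :=
  if n is n'.+1 then triangle_row A n' *m leading_submx A n'.+1
  else const_mx 1.

Definition triangle (R : nzRingType) (A : nat -> nat -> R) (n : nat)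
    (m : 'I_n.+1) : R :=
  triangle_row A n ord0 m.

(* The recursion starts at row 0 = (1), which gives the prescribed row 1. *)
Lemma triangle_row1 (R : nzRingType) (A : nat -> nat -> R) :
  triangle_row A 1 = leading_submx A 1.
Proof.
by apply/rowP => j; rewrite !mxE big_ord1 !mxE mul1r.
Qed.

Definition tangent_mx (R : nzRingType) (i j : nat) : R :=
  if (j - 1 <= i)%N then (j * (j + 1))%:R else 0.

(* Main.v *)
(* Since tan' = 1 + tan^2, the N-th derivative of tan is P_N(tan), where P_0 = X
   and P_(N+1) = (1 + X^2) P_N'.  With c(N, j) the coefficient of X^j in P_N,
   this reads c(N+1, j) = (j+1) c(N, j+1) + (j-1) c(N, j-1), so c counts weighted
   lattice paths.  Marking the up steps of these paths gives the closed form
     2 t(n, m) = (m+1) (m+2)! c(2n-m, m+1)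
   for the whole triangle, proved by induction on n: the row sums that define
   the next row telescope by the recurrence for c.  At m = 0 this is
   t(n, 0) = c(2n, 1) = c(2n+1, 0) = P_(2n+1)(tan 0). *)
Require Import Defs.
From mathcomp Require Import all_boot all_order all_algebra.
From mathcomp Require Import all_classical all_reals all_analysis.
From mathcomp Require Import zify.

Import GRing.Theory.
Import numFieldNormedType.Exports.
Local Open Scope ring_scope.

Fixpoint tan_poly (R : nzRingType) (n : nat) : {poly R} :=
  if n is n'.+1 then (1 + 'X^2) * (tan_poly R n')^`() else 'X.

Lemma derive1n_tan (R : realType) (n : nat) (x : R) :
  cos x != 0 -> (@tan R)^`(n)%classic x = (tan_poly R n).[tan x].
Proof.
elim: n x => [|n IHn] x cosx; first by rewrite derive1n0 hornerX.
(* The induction hypothesis needs a nonzero cosine; this is an open condition, so the equality holds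
   near [x] and can be differentiated there. *)
have near_x : \forall y \near x, cos y != 0.
  apply: (@cvgr_neq0 _ _ _ (nbhs x) _ _ (cos x)) => //.
  exact: continuous_cos.
rewrite derive1nS derive1E.
have -> : 'D_1 (@tan R)^`(n)%classic x =
          'D_1 (horner (tan_poly R n) \o @tan R) x.
  by apply: near_eq_derive; near do apply: IHn.
have dP := is_derive_poly (tan_poly R n) (tan x).
have dPtan := is_derive1_comp dP (is_derive_tan cosx).
rewrite (@derive_val _ _ _ _ _ _ _ dPtan) cos2_tan2 //.
by rewrite hornerM hornerD hornerC hornerXn mulrC.
Unshelve. all: by end_near.
Qed.

Lemma coef_tan_polyS (R : comNzRingType) (n j : nat) :
  (tan_poly R n.+1)`_j.+1 =
  (tan_poly R n)`_j.+2 *+ j.+2 + (tan_poly R n)`_j *+ j.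
Proof.
rewrite /= mulrDl mul1r coefD coef_deriv coefXnM.
by case: j => [|j] //=; rewrite subSS subn1 coef_deriv.
Qed.

Lemma coef_tan_poly_gt (R : comNzRingType) (n j : nat) :
  (n.+1 < j)%N -> (tan_poly R n)`_j = 0.
Proof.
elim: n j => [|n IHn] [|j] //; first by rewrite coefX; case: j.
by move=> nj; rewrite coef_tan_polyS !IHn ?mul0rn ?addr0 //; lia.
Qed.

Lemma sum_coef_tan_poly (R : comNzRingType) (n k : nat) : (k <= n.+1)%N ->
  \sum_(k <= i < n.+1) (tan_poly R (2 * n - i))`_i.+1 *+ (i.+1 * i.+2`!) =
  (tan_poly R (2 * n + 1 - k))`_k.+2 *+ k.+2`!.
Proof.
move=> kn.
(* By the coefficient recurrence each summand is [g i.+1 - g i]; [g n.+1] vanishes because its index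
   [n.+3] exceeds the degree bound [n.+1]. *)
pose g i : R := - ((tan_poly R (2 * n + 1 - i))`_i.+2 *+ i.+2`!).
rewrite (telescope_sumr_eq g) => [||i /andP[_ ilt]] //.
  by rewrite /g coef_tan_poly_gt ?mul0rn ?oppr0 ?sub0r ?opprK //; lia.
rewrite /g.
have -> : (2 * n + 1 - i = (2 * n - i).+1)%N by lia.
have -> : (2 * n + 1 - i.+1 = 2 * n - i)%N by lia.
by rewrite coef_tan_polyS opprK mulrnDl -!mulrnA -factS addrA addNr add0r.
Qed.

Lemma triangle_tangentE (R : comNzRingType) (n : nat) (m : 'I_n.+1) :
  triangle (tangent_mx R) m *+ 2 =
  (tan_poly R (2 * n - m))`_m.+1 *+ (m.+1 * m.+2`!).
Proof.
rewrite /triangle; elim: n m => [|n IHn] m.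
  by rewrite (ord1 m) mxE coefX.
rewrite mxE -sumrMnl.
have E (i : 'I_n.+1) : triangle_row (tangent_mx R) n ord0 i *
    leading_submx (tangent_mx R) n.+1 i m *+ 2 =
    if (m.-1 <= i)%N then
      (tan_poly R (2 * n - i))`_i.+1 *+ (i.+1 * i.+2`!) *+ (m.+1 * m.+2)
    else 0.
  rewrite mxE /tangent_mx -mulrnAl IHn addn1 subn1 /=.
  have -> : (m <= i.+1)%N = (m.-1 <= i)%N by lia.
  by case: ifP; rewrite ?mulr0 ?mulr_natr.
under eq_bigr do rewrite E.
rewrite -big_mkcond sumrMnl.
rewrite -(big_geq_mkord _ _ predT
  (fun i => (tan_poly R (2 * n - i))`_i.+1 *+ (i.+1 * i.+2`!))).
rewrite sum_coef_tan_poly; last by have := ltn_ord m; lia.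
(* Columns 0 and 1 both sum from [i = 0], as [m.-1] truncates. For column 0 one more use of the
   recurrence is needed, where the lower term has weight 0. *)
rewrite -mulrnA; case: m {E} => -[|m] mn; rewrite [nat_of_ord _]/=.
  rewrite !subn0.
  have -> : (2 * n.+1 = (2 * n + 1).+1)%N by lia.
  by rewrite coef_tan_polyS mulr0n addr0 -mulrnA.
have -> : (2 * n.+1 - m.+1 = 2 * n + 1 - m)%N by lia.
by rewrite succnK (factS m.+2) (mulnC m.+2`!) mulnA.
Qed.

Theorem theorem1p1 (R : realType) (n : nat) :
  triangle (tangent_mx R) (ord0 : 'I_n.+1) = (@tan R)^`(2 * n + 1)%classic 0.
Proof.
rewrite derive1n_tan ?cos0 ?oner_neq0 // tan0 horner_coef0 addn1.
have -> : (tan_poly R (2 * n).+1)`_0 = (tan_poly R (2 * n))`_1.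
  by rewrite /= mulrDl mul1r coefD coefXnM addr0 coef_deriv.
have := triangle_tangentE R n ord0.
rewrite subn0 mul1n -[LHS]mulr_natr -[RHS]mulr_natr; apply: mulIf.
by rewrite Num.Theory.pnatr_eq0.
Qed.
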